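(* Let $k$ be a field and let $x_1,\ldots,x_n$ and $y_1,\ldots,y_m$ be variables over $k$. Let $I$ be an ideal of the polynomial ring $R=k[x_1,\ldots,x_n]$ and let $J$ be an ideal of the polynomial ring $S=k[y_1,\ldots,y_m]$. Suppose that there exists an isomorphism of $k$-algebras $R/I\cong S/J$. Then $\mathrm{rt}(I)=\mathrm{rt}(J)$.
   Context: Relation type of an ideal: let $I=(f_1,\ldots,f_s)$ be an ideal of a Noetherian (commutative) ring $R$, and let $\mathbf{R}(I)=R[It]=\bigoplus_{q\ge 0}I^qt^q$ be its Rees algebra. Let $R[t_1,\ldots,t_s]$ be the polynomial ring with its standard grading ($\deg t_i=1$, elements of $R$ in degree $0$), let $\varphi:R[t_1,\ldots,t_s]\to\mathbf{R}(I)$ be the graded $R$-algebra homomorphism sending $t_i$ to $f_it$, and let $L=\ker(\varphi)=\bigoplus_{q\ge 1}L_q$. The relation type $\mathrm{rt}(I)$ is the least integer $N\ge 1$ such that $L$ is generated by its homogeneous elements of degree at most $N$. It is a known fact that $\mathrm{rt}(I)$ does not depend on the chosen finite generating set of $I$. The improper ideal has relation type $1$. *)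

(* Defs.v *)
From HB Require Import structures.
From mathcomp Require Import all_boot all_algebra.
From mathcomp Require Import ring_quotient.
From mathcomp Require Import boolp classical_sets.
From mathcomp Require Import mpoly.

Set Implicit Arguments.
Unset Strict Implicit.
Unset Printing Implicit Defensive.

Import GRing.Theory.

Local Open Scope ring_scope.
Local Open Scope quotient_scope.
Local Open Scope classical_set_scope.

Section Ideals.
Variable R : comNzRingType.

Definition is_ideal (I : set R) : Prop :=
  [/\ I 0, (forall x y, I x -> I y -> I (x + y))
    & (forall a x, I x -> I (a * x))].

Record ideal := Ideal { ideal_set :> R -> Prop; idealP : is_ideal ideal_set }.

Definition ideal_span (G : set R) : set R :=
  [set x | exists (m : nat) (a g : 'I_m -> R),
     (forall i, G (g i)) /\ x = \sum_i a i * g i].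

End Ideals.

(* The quotient type of [ring_quotient] is available for every additive
   subgroup, but it carries a ring structure only for proper ideals, so that
   the quotient ring is built here for an arbitrary ideal. *)
Section IdealQuotient.
Variables (R : comNzRingType) (I : ideal R).

Definition ideal_pred : {pred R} := fun x => `[< I x >].

Lemma ideal_predE x : (x \in ideal_pred) <-> I x.
Proof. by split => /asboolP. Qed.

Lemma ideal_pred_zmod_closed : zmod_closed ideal_pred.
Proof.
have [I0 ID IM] := idealP I; split=> [|x y]; first exact/ideal_predE.
move=> /ideal_predE Ix /ideal_predE Iy; apply/ideal_predE.
by apply: ID => //; rewrite -mulN1r; apply: IM.
Qed.

HB.instance Definition _ := GRing.isZmodClosed.Build R ideal_pred
  ideal_pred_zmod_closed.

Definition ideal_quot : Type := {ideal_quot ideal_pred}.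

HB.instance Definition _ := EqQuotient.on ideal_quot.
HB.instance Definition _ := Choice.on ideal_quot.
HB.instance Definition _ := GRing.Zmodule.on ideal_quot.
HB.instance Definition _ :=
  isZmodQuotient.Build R (Quotient.equiv ideal_pred) 0 -%R +%R
    ideal_quot (lock _) (@Quotient.pi_opp R ideal_pred)
    (@Quotient.pi_add R ideal_pred).

Lemma ideal_quot_eqP (x y : R) :
  \pi_ideal_quot x = \pi_ideal_quot y <-> I (x - y).
Proof.
by rewrite -ideal_predE (Quotient.idealrBE ideal_pred); split=> [/eqP|/eqP].
Qed.

Definition ideal_quot_one : ideal_quot := \pi_ideal_quot 1.
Definition ideal_quot_mul : ideal_quot -> ideal_quot -> ideal_quot :=
  lift_op2 ideal_quot *%R.

Lemma ideal_quot_reprB (x : R) : I (repr (\pi_ideal_quot x) - x).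
Proof. by apply/ideal_quot_eqP; rewrite reprK. Qed.

Lemma pi_ideal_quot_mul (x y : R) :
  \pi_ideal_quot (x * y) = ideal_quot_mul (\pi_ideal_quot x) (\pi_ideal_quot y).
Proof.
have [_ ID IM] := idealP I; rewrite /ideal_quot_mul; unlock; apply/esym/ideal_quot_eqP.
set x' := repr _; set y' := repr _.
have -> : x' * y' - x * y = y' * (x' - x) + x * (y' - y).
  by rewrite !mulrBr addrA [y' * x]mulrC subrK [y' * x']mulrC.
by apply: ID; apply: IM; apply: ideal_quot_reprB.
Qed.

Lemma ideal_quot_mulA : associative ideal_quot_mul.
Proof.
move=> u v w; rewrite -[u]reprK -[v]reprK -[w]reprK.
by rewrite -!pi_ideal_quot_mul mulrA.
Qed.

Lemma ideal_quot_mulC : commutative ideal_quot_mul.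
Proof. move=> u v; rewrite -[u]reprK -[v]reprK.
by rewrite -!pi_ideal_quot_mul mulrC. Qed.

Lemma ideal_quot_mul1 : left_id ideal_quot_one ideal_quot_mul.
Proof. by move=> u; rewrite -[u]reprK -pi_ideal_quot_mul mul1r. Qed.

Lemma ideal_quot_mulD : left_distributive ideal_quot_mul +%R.
Proof.
move=> u v w; rewrite -[u]reprK -[v]reprK -[w]reprK.
by rewrite -raddfD -!pi_ideal_quot_mul mulrDl raddfD.
Qed.

HB.instance Definition _ := GRing.Zmodule_isComPzRing.Build ideal_quot
  ideal_quot_mulA ideal_quot_mulC ideal_quot_mul1 ideal_quot_mulD.

End IdealQuotient.

Section AlgebraQuotient.
Variables (k : comNzRingType) (A : comAlgType k) (I : ideal A).

Definition ideal_quot_scale (c : k) : ideal_quot I -> ideal_quot I :=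
  lift_op1 (ideal_quot I) ( *:%R c).

Lemma pi_ideal_quot_scale (c : k) (x : A) :
  \pi_(ideal_quot I) (c *: x) = ideal_quot_scale c (\pi_(ideal_quot I) x).
Proof.
have [_ _ IM] := idealP I; rewrite /ideal_quot_scale; unlock; apply/esym/ideal_quot_eqP.
rewrite -scalerBr -[_ - _]mul1r scalerAl; apply: IM; exact: ideal_quot_reprB.
Qed.

Lemma ideal_quot_scaleA a b v :
  ideal_quot_scale a (ideal_quot_scale b v) = ideal_quot_scale (a * b) v.
Proof. by rewrite -[v]reprK -!pi_ideal_quot_scale scalerA. Qed.

Lemma ideal_quot_scale1 : left_id 1 ideal_quot_scale.
Proof. by move=> u; rewrite -[u]reprK -pi_ideal_quot_scale scale1r. Qed.

Lemma ideal_quot_scaleDr : right_distributive ideal_quot_scale +%R.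
Proof.
move=> a u v; rewrite -[u]reprK -[v]reprK.
by rewrite -raddfD -!pi_ideal_quot_scale scalerDr raddfD.
Qed.

Lemma ideal_quot_scaleDl v : {morph ideal_quot_scale^~ v : a b / a + b}.
Proof.
by move=> a b; rewrite -[v]reprK -!pi_ideal_quot_scale scalerDl raddfD.
Qed.

HB.instance Definition _ := GRing.Zmodule_isLmodule.Build k (ideal_quot I)
  ideal_quot_scaleA ideal_quot_scale1 ideal_quot_scaleDr ideal_quot_scaleDl.

Lemma ideal_quot_scaleAl (a : k) (u v : ideal_quot I) :
  a *: (u * v) = (a *: u) * v.
Proof.
rewrite -[u]reprK -[v]reprK.
have mulE x y : 
    \pi_(ideal_quot I) x * \pi_(ideal_quot I) y = \pi_(ideal_quot I) (x * y).
  by rewrite pi_ideal_quot_mul.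
have scaleE x : a *: \pi_(ideal_quot I) x = \pi_(ideal_quot I) (a *: x).
  by rewrite pi_ideal_quot_scale.
by rewrite mulE !scaleE mulE scalerAl.
Qed.

End AlgebraQuotient.

(* An isomorphism of k-algebras is a k-linear ring isomorphism; the structure
   [GRing.LRMorphism] does not apply, as the algebra structures of the library
   exclude the zero ring, which occurs here for I = (1). *)
Definition quot_algebra_isomorphic (k : comNzRingType) (A B : comAlgType k)
    (I : ideal A) (J : ideal B) : Prop :=
  exists f : {rmorphism ideal_quot I -> ideal_quot J},
    scalable f /\ bijective f.

Section RelationType.
Variable R : comNzRingType.

(* The Rees algebra R[It] is a subring of R[t] containing the image of this
   map, so that the kernel may be computed with values in R[t]. *)
Definition rees_map (s : nat) (f : 'I_s -> R) (p : {mpoly R[s]}) : {poly R} :=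
  mmap polyC (fun i => f i *: 'X) p.

Definition rees_kernel (s : nat) (f : 'I_s -> R) : set {mpoly R[s]} :=
  [set p | rees_map f p = 0].

Definition rees_kernel_generated_upto (s : nat) (f : 'I_s -> R) (N : nat)
    : Prop :=
  rees_kernel f =
  ideal_span [set p | rees_kernel f p /\
                      exists2 d, (d <= N)%N & p \is d.-homog].

Definition relation_type_wrt (s : nat) (f : 'I_s -> R) (N : nat) : Prop :=
  [/\ (1 <= N)%N, rees_kernel_generated_upto f N
    & forall M, (1 <= M)%N -> rees_kernel_generated_upto f M -> (N <= M)%N].

(* For R Noetherian there is exactly one such N; the default value 0 only
   occurs over non-Noetherian rings. *)
Definition relation_type (I : ideal R) : nat :=
  xget 0%N [set N | exists (s : nat) (f : 'I_s -> R),
    ideal_set I = ideal_span (range f) /\ relation_type_wrt f N].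

End RelationType.

(* Main.v *)
Require Import Defs.
From HB Require Import structures.
From mathcomp Require Import all_boot all_algebra.
From mathcomp Require Import boolp classical_sets.
From mathcomp Require Import mpoly.

(* A surjection of [k[x, y]] onto [R/I = S/J] presents the common quotient by
   an ideal which is, up to a change of variables, both [(I, y)] and [(J, x)],
   so that it is enough to compare [I] with [(I, y)] for a new variable [y].
   Modulo the linear relations [y t_i - f_i v], where [v] is the Rees variable
   of [y], every relation of [(f, y)] is a sum of terms [v^b P_b(t)] and
   [c y^(a+1) v^d]; comparing degrees in [y] forces every [P_b] to be a
   relation of [f] and every [c] to vanish. Conversely, relations descend along
   a retraction of rings compatible with the ideals. *)

Set Implicit Arguments.
Unset Strict Implicit.
Unset Printing Implicit Defensive.

Import GRing.Theory.

Local Open Scope ring_scope.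
Local Open Scope classical_set_scope.

(** * Ideals and their generators *)

Section Ideals.
Variable R : comNzRingType.
Implicit Types (K : set R) (G : set R).

Lemma is_idealN K x : is_ideal K -> K x -> K (- x).
Proof. by case=> _ _ KM Kx; rewrite -mulN1r; apply: KM. Qed.

Lemma is_idealB K x y : is_ideal K -> K x -> K y -> K (x - y).
Proof. by move=> idK Kx Ky; have [_ KD _] := idK; apply: KD => //; apply: is_idealN. Qed.

Lemma is_ideal_sum K m (F : 'I_m -> R) :
  is_ideal K -> (forall i, K (F i)) -> K (\sum_i F i).
Proof. by case=> K0 KD _ KF; apply: (big_ind K) => // i _; apply: KF. Qed.

Lemma is_ideal_span G : is_ideal (ideal_span G).
Proof.
split=> [|_ _ [m1 [a1 [g1 [G1 ->]]]] [m2 [a2 [g2 [G2 ->]]]]|c _ [m [a [g [Gg ->]]]]].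
- by exists 0%N, (fun=> 0), (fun=> 0); split=> [[]|] //; rewrite big_ord0.
- exists (m1 + m2)%N, (fun i => match split i with inl j => a1 j | inr j => a2 j end).
  exists (fun i => match split i with inl j => g1 j | inr j => g2 j end).
  split=> [i|]; first by case: split.
  rewrite big_split_ord; congr (_ + _); apply: eq_bigr => i _.
    by rewrite -[lshift _ i]/(unsplit (inl i)) unsplitK.
  by rewrite -[rshift _ i]/(unsplit (inr i)) unsplitK.
- exists m, (fun i => c * a i), g; split=> //.
  by rewrite mulr_sumr; apply: eq_bigr => i _; rewrite mulrA.
Qed.

Lemma ideal_span_incl G x : G x -> ideal_span G x.
Proof.
move=> Gx; exists 1%N, (fun=> 1), (fun=> x); split=> //.
by rewrite big_ord1 mul1r.
Qed.

Lemma ideal_span_sub G K : is_ideal K -> G `<=` K -> ideal_span G `<=` K.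
Proof.
move=> idK GK _ [m [a [g [Gg ->]]]]; apply: is_ideal_sum => // i.
by have [_ _] := idK; apply; apply: GK.
Qed.

Lemma ideal_span_range s (f : 'I_s -> R) x :
  ideal_span (range f) x -> exists a, x = \sum_i a i * f i.
Proof.
apply: (@ideal_span_sub _ [set x | exists a, x = \sum_i a i * f i]).
  split=> [|_ _ [a ->] [b ->]|c _ [a ->]].
  - by exists (fun=> 0); rewrite big1 // => i _; rewrite mul0r.
  - exists (fun i => a i + b i); rewrite -big_split; apply: eq_bigr => i _.
    by rewrite mulrDl.
  - by exists (fun i => c * a i); rewrite mulr_sumr; apply: eq_bigr => i _; rewrite mulrA.
move=> _ [i _ <-]; exists (fun j => (j == i)%:R).
rewrite (bigD1 i) //= eqxx mul1r big1 ?addr0 // => j /negPf->.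
by rewrite mul0r.
Qed.

End Ideals.

Lemma is_ideal_preim (A B : comNzRingType) (h : {rmorphism A -> B}) (K : set B) :
  is_ideal K -> is_ideal (h @^-1` K).
Proof.
case=> K0 KD KM; split=> /= [|x y|a x]; rewrite ?rmorph0 ?rmorphD ?rmorphM //.
  exact: KD.
exact: KM.
Qed.

Lemma is_ideal0 (A : comNzRingType) : is_ideal [set 0 : A].
Proof. by split=> [|x y -> ->|a x ->] //=; rewrite ?addr0 ?mulr0. Qed.

(** * Ring morphisms out of a polynomial ring *)

Section MpolyMorphisms.
Variables (A : comNzRingType) (s : nat).

Lemma mpoly_generated_ind (P : {mpoly A[s]} -> Prop) :
    P 1 -> (forall p q, P p -> P q -> P (p + q)) ->
    (forall c p, P p -> P (c%:MP * p)) -> (forall i p, P p -> P ('X_i * p)) ->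
  forall p, P p.
Proof.
move=> P1 PD PC PX; elim/mpolyind => [|c m p _ _ Pp].
  by rewrite -(mul0r 1) -mpolyC0; apply: PC.
apply: PD => //; rewrite -mul_mpolyC; apply: PC; rewrite -[X in P X]mulr1.
move: {p Pp} 1 P1; rewrite mpolyXE_id.
(* [Q r] says that multiplication by [r] preserves [P]; this is multiplicative in [r], so it passes
   from variables to monomials. *)
pose Q r := forall q, P q -> P (r * q : {mpoly A[s]}).
have QM p q : Q p -> Q q -> Q (p * q).
  by move=> Qp Qq r Pr; rewrite -mulrA; apply/Qp/Qq.
have Q1 : Q 1 by move=> q; rewrite mul1r.
apply: (big_ind Q) => // i _; elim: (m i) => [|e IHe]; first by rewrite expr0.
by rewrite exprS; apply: QM => // q; apply: PX.
Qed.

(** Modulo [K] both maps become ring maps to a quotient, so generators suffice; products are handled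
    by inserting the mixed term [g p * h x]. *)
Lemma mpoly_morph_congr (C : comNzRingType) (K : set C)
    (g h : {rmorphism {mpoly A[s]} -> C}) :
  is_ideal K -> (forall c, K (g c%:MP - h c%:MP)) ->
  (forall i, K (g 'X_i - h 'X_i)) -> forall p, K (g p - h p).
Proof.
move=> idK KC KX; have [K0 KD KM] := idK.
have KMM x p : K (g x - h x) -> K (g p - h p) -> K (g (x * p) - h (x * p)).
  move=> Kx Kp; rewrite !rmorphM.
  have -> : g x * g p - h x * h p = g p * (g x - h x) + h x * (g p - h p).
    by rewrite !mulrBr addrA [g p * h x]mulrC subrK [g p * _]mulrC.
  by apply: KD; apply: KM.
apply: mpoly_generated_ind => [|p q Kp Kq|c p|i p]; last 2 first.
- exact: KMM.
- exact: KMM.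
- by rewrite !rmorph1 subrr.
- by rewrite !rmorphD opprD addrACA; apply: KD.
Qed.

Lemma mpoly_morph_ext (C : comNzRingType) (g h : {rmorphism {mpoly A[s]} -> C}) :
  (forall c, g c%:MP = h c%:MP) -> (forall i, g 'X_i = h 'X_i) -> g =1 h.
Proof.
move=> ghC ghX p; apply/subr0_eq.
by apply: (mpoly_morph_congr (@is_ideal0 C)) => i /=; rewrite ?ghC ?ghX subrr.
Qed.

End MpolyMorphisms.

(** * The Rees map and its linear relations *)

HB.instance Definition _ (R : comNzRingType) s (f : 'I_s -> R) :=
  GRing.RMorphism.copy (rees_map f) (mmap polyC (fun i => f i *: 'X)).

Section ReesMap.
Variables (R : comNzRingType) (s : nat) (f : 'I_s -> R).

Lemma rees_mapC c : rees_map f c%:MP = c%:P.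
Proof. exact: mmapC. Qed.

Lemma rees_mapX i : rees_map f 'X_i = f i *: 'X.
Proof. by rewrite /rees_map mmapX mmap1U. Qed.

Lemma rees_mapZ c p : rees_map f (c *: p) = c *: rees_map f p.
Proof. by rewrite -mul_mpolyC rmorphM /= rees_mapC mul_polyC. Qed.

Lemma is_ideal_rees_kernel : is_ideal (rees_kernel f).
Proof. exact: (is_ideal_preim _ (@is_ideal0 _)). Qed.

Definition rees_relation_upto N : set {mpoly R[s]} :=
  [set p | rees_kernel f p /\ exists2 d, (d <= N)%N & p \is d.-homog].

Lemma rees_kernel_generated_uptoP N :
  rees_kernel_generated_upto f N <->
  rees_kernel f `<=` ideal_span (rees_relation_upto N).
Proof.
split=> [E|sub]; first by rewrite {1}E.
apply/seteqP; split=> //; apply: ideal_span_sub; first exact: is_ideal_rees_kernel.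
by move=> p [].
Qed.

Lemma linear_relation N p : (0 < N)%N -> rees_kernel f p -> p \is 1.-homog ->
  ideal_span (rees_relation_upto N) p.
Proof. by move=> N0 Lp p1; apply: ideal_span_incl; split=> //; exists 1%N. Qed.

Definition linear_form (b : 'I_s -> R) : {mpoly R[s]} := \sum_j b j *: 'X_j.

Lemma homog_linear_form b : linear_form b \is 1.-homog.
Proof.
by apply: rpred_sum => j _; apply: dhomogZ; rewrite dhomogX; apply/eqP/mdeg1.
Qed.

Lemma rees_map_linear_form b :
  rees_map f (linear_form b) = (\sum_j b j * f j) *: 'X.
Proof.
rewrite /linear_form raddf_sum scaler_suml; apply: eq_bigr => j _.
by rewrite /= rees_mapZ rees_mapX scalerA.
Qed.

End ReesMap.

(** * Graded maps covering a change of base ring *)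

Section GradedLift.
Variables (A B : comNzRingType) (s t : nat) (sigma : {rmorphism A -> B}).
Variable b : 'I_s -> {mpoly B[t]}.

Definition mpoly_lift : {mpoly A[s]} -> {mpoly B[t]} :=
  mmap (@mpolyC t B \o sigma) b.

HB.instance Definition _ := GRing.RMorphism.copy mpoly_lift
  (mmap (@mpolyC t B \o sigma) b).

Lemma mpoly_liftC c : mpoly_lift c%:MP = (sigma c)%:MP.
Proof. exact: mmapC. Qed.

Lemma mpoly_liftX i : mpoly_lift 'X_i = b i.
Proof. by rewrite /mpoly_lift mmapX mmap1U. Qed.

Hypothesis b_homog : forall i, b i \is 1.-homog.

Lemma homog_mpoly_lift d p : p \is d.-homog -> mpoly_lift p \is d.-homog.
Proof.
move=> /dhomogP hp; rewrite /mpoly_lift /mmap big_seq; apply: rpred_sum => m /hp dm.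
rewrite mul_mpolyC; apply: dhomogZ.
have -> : d = (\sum_i m i)%N by rewrite -dm; apply: mdegE.
rewrite /mmap1.
(* The induction carries the degree along with the partial product, each factor [b i ^+ m i]
   contributing [m i]. *)
apply: (big_ind2 (fun (q : {mpoly B[t]}) e => q \is e.-homog)) => [|q1 e1 q2 e2|i _].
- exact: dhomog1.
- exact: dhomogM.
- by rewrite -[X in X.-homog]mul1n; apply: dhomogMn.
Qed.

Variables (f : 'I_s -> A) (g : 'I_t -> B).
Hypothesis rees_b : forall i, rees_map g (b i) = sigma (f i) *: 'X.

Lemma rees_map_lift p :
  rees_map g (mpoly_lift p) = map_poly sigma (rees_map f p).
Proof.
apply: (mpoly_morph_ext (g := rees_map g \o mpoly_lift)
  (h := map_poly sigma \o rees_map f)) => [c|i] /=.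
  by rewrite mpoly_liftC !rees_mapC map_polyC.
by rewrite mpoly_liftX rees_mapX rees_b map_polyZ map_polyX.
Qed.

Lemma rees_kernel_lift p : rees_kernel f p -> rees_kernel g (mpoly_lift p).
Proof. by rewrite /rees_kernel /= rees_map_lift => ->; rewrite rmorph0. Qed.

Lemma rees_relations_lift N p : ideal_span (rees_relation_upto f N) p ->
  ideal_span (rees_relation_upto g N) (mpoly_lift p).
Proof.
set V := ideal_span (rees_relation_upto g N).
move: p; apply: (@ideal_span_sub _ _ (mpoly_lift @^-1` V)).
  exact/is_ideal_preim/is_ideal_span.
move=> q [Lq [d dN hq]]; apply: ideal_span_incl; split; first exact: rees_kernel_lift.
by exists d => //; apply: homog_mpoly_lift.
Qed.

End GradedLift.

(** Expanding each [sigma (f i)] over [g] and using the coefficients in a linear form yields the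
    data of a graded lift along [sigma]. *)
Lemma ideal_span_linear_forms (A B : comNzRingType) s t (sigma : A -> B)
    (f : 'I_s -> A) (g : 'I_t -> B) :
  (forall i, ideal_span (range g) (sigma (f i))) ->
  exists b : 'I_s -> {mpoly B[t]}, (forall i, b i \is 1.-homog) /\
    forall i, rees_map g (b i) = sigma (f i) *: 'X.
Proof.
move=> fg; have /choice[b bE] := fun i => ideal_span_range (fg i).
exists (fun i => linear_form (b i)); split=> i; first exact: homog_linear_form.
by rewrite rees_map_linear_form -bE.
Qed.

(* The composite of the two graded lifts differs from the identity by linear
   relations only; with A = B this is the independence of generators. *)
Lemma rees_kernel_generated_retract (A B : comNzRingType) s t
    (sigma : {rmorphism A -> B}) (tau : {rmorphism B -> A})
    (f : 'I_s -> A) (g : 'I_t -> B) N :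
  cancel sigma tau -> (forall i, ideal_span (range g) (sigma (f i))) ->
  (forall j, ideal_span (range f) (tau (g j))) -> (0 < N)%N ->
  rees_kernel_generated_upto g N -> rees_kernel_generated_upto f N.
Proof.
move=> sK /ideal_span_linear_forms[b [b1 rb]] /ideal_span_linear_forms[c [c1 rc]] N0.
move=> /rees_kernel_generated_uptoP Gg; apply/rees_kernel_generated_uptoP => p Lp.
set V := ideal_span _; have idV : is_ideal V by apply: is_ideal_span.
pose T := mpoly_lift tau c; pose S := mpoly_lift sigma b.
(* [S p] is a relation of [g], hence generated in degree at most [N], and [T] preserves this. *)
have VTS : V (T (S p)).
  by apply: (rees_relations_lift c1 rc); apply: Gg; apply: rees_kernel_lift Lp.
rewrite -(subrK (T (S p)) p); have [_ VD _] := idV; apply: VD => //.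
apply: (mpoly_morph_congr (g := idfun) (h := T \o S)) => // [a|i] /=.
  by rewrite /S mpoly_liftC /T mpoly_liftC sK subrr; case: idV.
apply: linear_relation => //.
  rewrite /rees_kernel /= rmorphB /= /T (rees_map_lift rc) /S mpoly_liftX rb.
  by rewrite rees_mapX map_polyZ map_polyX sK subrr.
apply: rpredB; first by rewrite dhomogX; apply/eqP/mdeg1.
by apply: homog_mpoly_lift => //; rewrite /S mpoly_liftX.
Qed.

(** * Adjoining one variable to the ring and to the ideal *)

Section AdjoinVariable.
Variables (R : comNzRingType) (s : nat) (f : 'I_s -> R).

Definition adjoin_var (i : 'I_s.+1) : {poly R} :=
  if unlift ord0 i is Some j then (f j)%:P else 'X.

Lemma adjoin_var0 : adjoin_var ord0 = 'X.
Proof. by rewrite /adjoin_var unlift_none. Qed.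

Lemma adjoin_var_lift j : adjoin_var (lift ord0 j) = (f j)%:P.
Proof. by rewrite /adjoin_var liftK. Qed.

Local Notation M := {mpoly {poly R}[s.+1]}.
Let v : M := 'X_ord0.
Let t (j : 'I_s) : M := 'X_(lift ord0 j).
Let y : M := 'X%:MP.

Definition embed_rees : {mpoly R[s]} -> M := mpoly_lift polyC t.

HB.instance Definition _ := GRing.RMorphism.copy embed_rees (mpoly_lift polyC t).

Let t_homog j : t j \is 1.-homog.
Proof. by rewrite dhomogX; apply/eqP/mdeg1. Qed.

Let rees_t j : rees_map adjoin_var (t j) = (f j)%:P *: 'X.
Proof. by rewrite rees_mapX adjoin_var_lift. Qed.

Lemma embed_reesC c : embed_rees c%:MP = c%:P%:MP.
Proof. exact: mpoly_liftC. Qed.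

Lemma embed_reesX j : embed_rees 'X_j = 'X_(lift ord0 j).
Proof. exact: mpoly_liftX. Qed.

(** [P] is a polynomial in [v] over [R[t]], [C] one over [R[y]]: [y] and the [t j] never meet in a
    term, and the factor [y] in front keeps the two parts disjoint. *)
Definition normal_form (P : {poly {mpoly R[s]}}) (C : {poly {poly R}}) : M :=
  (map_poly embed_rees P).[v] + y * (map_poly (@mpolyC s.+1 {poly R}) C).[v].

Lemma normal_formD P1 C1 P2 C2 :
  normal_form (P1 + P2) (C1 + C2) = normal_form P1 C1 + normal_form P2 C2.
Proof. by rewrite /normal_form !rmorphD /= !hornerD mulrDr addrACA. Qed.

(* The summand with index j of the Rees image of the P-part has degree at most
   j in 'X, while the C-part is a multiple of 'X^j.+1. *)
Lemma normal_form_kernel P C : rees_kernel adjoin_var (normal_form P C) ->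
  (forall i, rees_kernel f P`_i) /\ C = 0.
Proof.
pose r : {rmorphism M -> {poly {poly R}}} := rees_map adjoin_var.
have rE Q : r (embed_rees Q) = map_poly polyC (rees_map f Q).
  exact: (rees_map_lift rees_t).
have ry : r y = 'X%:P by apply: rees_mapC.
have rv : r v = 'X *: 'X by rewrite /= rees_mapX adjoin_var0.
rewrite /rees_kernel /= -[rees_map _ _]/(r _) /normal_form.
have -> : (map_poly embed_rees P).[v] = \sum_(i < size P) embed_rees P`_i * v ^+ i.
  rewrite (horner_coef_wide _ (size_poly _ _)).
  by apply: eq_bigr => i _; rewrite coef_map.
have -> : (map_poly (@mpolyC s.+1 {poly R}) C).[v] = \sum_(i < size C) (C`_i)%:MP * v ^+ i.
  rewrite (horner_coef_wide _ (size_poly _ _)).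
  by apply: eq_bigr => i _; rewrite coef_map.
rewrite rmorphD rmorphM ry !raddf_sum => /polyP E.
have coef_P (j : nat) : (\sum_(i < size P) r (embed_rees P`_i * v ^+ i))`_j =
    \sum_(i < size P) (if (j < i)%N then 0 else ((rees_map f P`_i)`_(j - i))%:P * 'X^i).
  rewrite coef_sum; apply: eq_bigr => i _; rewrite rmorphM rmorphXn rE rv.
  rewrite exprZn -scalerAr coefZ coefMXn; case: ifP; first by rewrite mulr0.
  by rewrite coef_map mulrC.
have coef_C (j : nat) : (\sum_(i < size C) r ((C`_i)%:MP * v ^+ i))`_j = C`_j * 'X^j.
  rewrite coef_sum.
  have rC i : r ((C`_i)%:MP * v ^+ i) = (C`_i * 'X^i) *: 'X^i.
    rewrite rmorphM rmorphXn rv /= rees_mapC exprZn mul_polyC.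
    by rewrite scalerA.
  case: (ltnP j (size C)) => jC.
    rewrite (bigD1 (Ordinal jC)) //= rC coefZ coefXn eqxx mulr1 big1 ?addr0 //.
    move=> i ij; rewrite rC coefZ coefXn eq_sym.
    by rewrite (negPf (ij : (i != j :> nat))) mulr0.
  rewrite nth_default // mul0r big1 // => i _; rewrite rC coefZ coefXn.
  by rewrite gtn_eqF ?mulr0 // (leq_trans (ltn_ord i)).
(* In Rees degree [b + e], the coefficient of ['X^b] sees only the summand [i = b], since the
   [C]-part there is divisible by ['X^(b + e).+1]. *)
have P0 b e : (rees_map f P`_b)`_e = 0.
  case: (ltnP b (size P)) => bP; last by rewrite [P`_b]nth_default // rmorph0 coef0.
  move: (E (b + e)%N); rewrite coefD coefCM coef_P coef_C coef0 => /(congr1 (coefp b)) /=.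
  rewrite coefD coef0 mulrCA -exprS coefMXn ltnS leq_addr addr0 => Eb.
  rewrite -[RHS]Eb (bigD1 (Ordinal bP)) //= ltnNge leq_addr /= addKn coefD coefCM.
  rewrite coefXn eqxx mulr1 [X in _ + X]coef_sum big1 ?addr0 // => i ib; case: ifP => _; first by rewrite coef0.
  by rewrite coefCM coefXn eq_sym (negPf (ib : (i != b :> nat))) mulr0.
split=> [i|]; first by apply/polyP => e; rewrite P0 coef0.
(* With the [P]-part gone, the product of ['X^j.+1] and the coefficient [C]_j[is zero; reading
   coefficients past the shift gives]C[_j = 0]. *)
apply/polyP => j; rewrite coef0; move: (E j); rewrite coefD coefCM coef_P coef_C coef0.
rewrite big1 => [|i _]; last first.
  by case: ifP => // _; rewrite P0 mul0r.
rewrite add0r mulrCA -exprS => /polyP E'.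
by apply/polyP => e; move: (E' (j.+1 + e)%N); rewrite coefMXn ltnNge leq_addr addKn !coef0.
Qed.

Variables (N : nat).
Hypotheses (N_gt0 : (0 < N)%N) (genf : rees_kernel_generated_upto f N).

Let V := ideal_span (rees_relation_upto adjoin_var N).
Let idV : is_ideal V := is_ideal_span _.

(** The Koszul relation between ['X] and [f j]; it is linear, hence in [V] as [N] is positive. *)
Let koszul j : V (y * t j - embed_rees (f j)%:MP * v).
Proof.
apply: linear_relation => //; last first.
  rewrite embed_reesC !mul_mpolyC.
  by rewrite rpredB //; apply: dhomogZ; rewrite dhomogX; apply/eqP/mdeg1.
rewrite /rees_kernel /= rmorphB /= embed_reesC !mul_mpolyC !rees_mapZ.
by rewrite rees_t rees_mapX adjoin_var0 !scalerA mulrC subrr.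
Qed.

(** The polynomials with a normal form modulo [V]. Closure under sums and under multiplication by
    constants and variables will show that [W] is everything. *)
Let W : set M := [set p | exists P C, V (p - normal_form P C)].

Let WD p q : W p -> W q -> W (p + q).
Proof.
move=> [P1 [C1 V1]] [P2 [C2 V2]]; exists (P1 + P2), (C1 + C2).
by rewrite normal_formD opprD addrACA; case: idV => _ VD _; apply: VD.
Qed.

Let W_congr p q : V (p - q) -> W q -> W p.
Proof.
move=> Vpq [P [C Vq]]; exists P, C; rewrite -(subrK q p) -addrA.
by case: idV => _ VD _; apply: VD.
Qed.

Let W_normal P C : W (normal_form P C).
Proof. by exists P, C; rewrite subrr; case: idV. Qed.

Let W0 : W 0.
Proof. by move: (W_normal 0 0); rewrite /normal_form !rmorph0 !horner0 mulr0 addr0. Qed.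

Let W_embed Q : W (embed_rees Q).
Proof.
move: (W_normal Q%:P 0); rewrite /normal_form rmorph0 horner0 mulr0 addr0.
by rewrite map_polyC hornerC.
Qed.

Let W_yC c : W (y * c%:MP).
Proof.
move: (W_normal 0 c%:P); rewrite /normal_form rmorph0 horner0 add0r.
by rewrite map_polyC hornerC.
Qed.

Let Wv p : W p -> W (p * v).
Proof.
move=> [P [C Vp]]; apply: (@W_congr _ (normal_form P C * v)).
  by rewrite -mulrBl mulrC; case: idV => _ _; apply.
move: (W_normal (P * 'X) (C * 'X)).
by rewrite /normal_form !rmorphM /= !map_polyX !hornerMX mulrA -mulrDl.
Qed.

Let WC c : W c%:MP.
Proof.
elim/poly_ind: c => [|c a _]; first by rewrite mpolyC0.
rewrite mpolyCD mpolyCM [_ * 'X%:MP]mulrC; apply: WD; first exact: W_yC.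
by move: (W_embed a%:MP); rewrite embed_reesC.
Qed.

(** Normal forms are Horner schemes in [v] and [W] is stable under [v], so multiplication by [z]
    need only be checked on the coefficients of the two parts. *)
Let W_mul z : (forall Q, W (z * embed_rees Q)) -> (forall c, W (z * (y * c%:MP))) ->
  forall p, W p -> W (z * p).
Proof.
move=> zE zC p [P [C Vp]]; apply: (@W_congr _ (z * normal_form P C)).
  by rewrite -mulrBr; case: idV => _ _; apply.
rewrite /normal_form mulrDr; apply: WD; clear Vp.
  elim/poly_ind: P => [|P Q IHP]; first by rewrite rmorph0 horner0 mulr0; apply: W0.
  rewrite rmorphD rmorphM /= map_polyX map_polyC hornerMXaddC mulrDr mulrA.
  by apply: WD (zE Q); apply: Wv.
elim/poly_ind: C => [|C c IHC]; first by rewrite rmorph0 horner0 !mulr0; apply: W0.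
rewrite rmorphD rmorphM /= map_polyX map_polyC hornerMXaddC mulrDr mulrA mulrDr.
by apply: WD (zC c); rewrite mulrA; apply: Wv.
Qed.

Let W_all p : W p.
Proof.
have Wt j q : W q -> W (t j * q).
  apply: W_mul => [Q|c].
    by move: (W_embed ('X_j * Q)); rewrite rmorphM /= embed_reesX.
  (* The Koszul relation trades the mixed product [t j * y] for [f j * v]. *)
  apply: (@W_congr _ (((f j)%:P * c)%:MP * v)); last exact/Wv/WC.
  have -> : t j * (y * c%:MP) - ((f j)%:P * c)%:MP * v =
      c%:MP * (y * t j - embed_rees (f j)%:MP * v).
    rewrite embed_reesC mpolyCM mulrBr; congr (_ - _).
      by rewrite mulrA mulrC [t j * y]mulrC.
    by rewrite mulrA [c%:MP * _]mulrC.
  by case: idV => _ _; apply; apply: koszul.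
have Wy q : W q -> W (y * q).
  apply: W_mul => [|c]; last by rewrite -mpolyCM; apply: W_yC.
  (* Induction on [Q]: a factor [t j] is consumed together with [y] by the Koszul relation, leaving
     a multiple of [v]. *)
  apply: mpoly_generated_ind => [|P Q|c Q|j Q _].
  - by rewrite rmorph1 mulr1; apply: WC.
  - by rewrite rmorphD mulrDr; apply: WD.
  - rewrite rmorphM /= embed_reesC mulrCA; apply: W_mul => Q'.
      by move: (W_embed (c%:MP * Q')); rewrite rmorphM /= embed_reesC.
    by rewrite mulrCA -mpolyCM; apply: W_yC.
  rewrite rmorphM /= embed_reesX mulrA.
  apply: (@W_congr _ (embed_rees (f j)%:MP * v * embed_rees Q)).
    by rewrite -mulrBl mulrC; case: idV => _ _; apply; apply: koszul.
  by rewrite mulrAC -rmorphM; apply: Wv.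
elim/mpoly_generated_ind: p => [|p q|c p Wp|i p].
- exact: WC.
- exact: WD.
- elim/poly_ind: c => [|c a IHc]; first by rewrite mpolyC0 mul0r; apply: W0.
  rewrite mpolyCD mpolyCM mulrDl; apply: WD.
    by rewrite -mulrA mulrCA; apply: Wy.
  apply: W_mul Wp => [Q|b].
    by move: (W_embed (a%:MP * Q)); rewrite rmorphM /= embed_reesC.
  by rewrite mulrCA -mpolyCM; apply: W_yC.
- by case: (unliftP ord0 i) => [j|] ->; [apply: Wt | rewrite mulrC; apply: Wv].
Qed.

Lemma rees_kernel_generated_adjoin : rees_kernel_generated_upto adjoin_var N.
Proof.
apply/rees_kernel_generated_uptoP => p Lp; rewrite -/V.
have [P [C Vp]] := W_all p; have [_ VD VM] := idV.
have [|kP C0] := @normal_form_kernel P C.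
  (* The normal form is itself a relation, since [V] consists of relations. *)
  have -> : normal_form P C = p - (p - normal_form P C) by rewrite opprB addrC subrK.
  apply: is_idealB => //; first exact: is_ideal_rees_kernel.
  by move: Vp; apply: ideal_span_sub; [apply: is_ideal_rees_kernel | move=> q []].
(* What remains is a combination of powers of [v] with embedded relations of [f], which are
   generated in degree at most [N]. *)
rewrite -(subrK (normal_form P C) p); apply: VD => //; rewrite /normal_form C0.
rewrite rmorph0 horner0 mulr0 addr0 (horner_coef_wide _ (size_poly _ _)).
apply: is_ideal_sum => // i; rewrite coef_map mulrC; apply: VM.
apply: (rees_relations_lift t_homog rees_t).
by move/rees_kernel_generated_uptoP: genf; apply.
Qed.

End AdjoinVariable.

(** * Adjoining several variables and descending along a retraction *)

Lemma ideal_span_morph (A B : comNzRingType) (h : {rmorphism A -> B})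
    (G : set A) (K : set B) :
  is_ideal K -> (forall x, G x -> K (h x)) -> forall x, ideal_span G x -> K (h x).
Proof.
by move=> idK GK; apply: (@ideal_span_sub _ _ (h @^-1` K)) => //; apply: is_ideal_preim.
Qed.

(* [T] is the polynomial ring S[X_1, ..., X_n], given by its universal property
   in order to adjoin the variables one at a time; [G] lists [g] and [X]. *)
Lemma rees_kernel_generated_adjoin_vars (S : comNzRingType) t (g : 'I_t -> S) N n :
  (0 < N)%N -> rees_kernel_generated_upto g N ->
  exists (T : comNzRingType) (iota : {rmorphism S -> T}) (X : 'I_n -> T) (r : nat)
    (G : 'I_r -> T),
    [/\ rees_kernel_generated_upto G N,
        forall j, ideal_span (range G) (iota (g j)),
        forall i, ideal_span (range G) (X i),
        forall l, (exists j, G l = iota (g j)) \/ exists i, G l = X i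
      & forall (Q : comNzRingType) (psi : {rmorphism S -> Q}) (q : 'I_n -> Q),
          exists tau : {rmorphism T -> Q},
            (forall x, tau (iota x) = psi x) /\ forall i, tau (X i) = q i].
Proof.
move=> N0 Gg; elim: n => [|n [T [iota [X [r [G [GN Gi GX Gl univ]]]]]]].
  exists S, idfun, (fun=> 0), t, g; split=> // [j|[]//|l|Q psi q].
  - by apply: ideal_span_incl; exists j.
  - by left; exists l.
  - by exists psi; split=> // -[].
have polyCG x : ideal_span (range G) x -> ideal_span (range (adjoin_var G)) x%:P.
  apply: ideal_span_morph; first exact: is_ideal_span.
  move=> _ [l _ <-]; apply: ideal_span_incl; exists (lift ord0 l) => //.
  exact: adjoin_var_lift.
(* [adjoin_var] serves twice: on [G] it extends the generators, on [X] the list of adjoined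
   variables, with the new variable at [ord0]. *)
exists {poly T}, (polyC \o iota), (adjoin_var X), r.+1, (adjoin_var G); split.
- exact: rees_kernel_generated_adjoin.
- by move=> j; apply: polyCG.
- move=> i; case: (unliftP ord0 i) => [j|] ->; last first.
    rewrite adjoin_var0; apply: ideal_span_incl; exists ord0 => //.
    exact: adjoin_var0.
  by rewrite adjoin_var_lift; apply: polyCG.
- move=> l; case: (unliftP ord0 l) => [l'|] ->; last first.
    by right; exists ord0; rewrite !adjoin_var0.
  rewrite adjoin_var_lift; case: (Gl l') => [[j ->]|[i ->]]; first by left; exists j.
  by right; exists (lift ord0 i); rewrite adjoin_var_lift.
- move=> Q psi q; have [tau [tauC tauX]] := univ Q psi (fun i => q (lift ord0 i)).
  have cq : commr_rmorph tau (q ord0) by move=> x; apply: mulrC.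
  exists (horner_morph cq); split=> [x|i] /=; first by rewrite horner_morphC.
  case: (unliftP ord0 i) => [j|] ->; last by rewrite adjoin_var0 horner_morphX.
  by rewrite adjoin_var_lift horner_morphC.
Qed.

(* [k[x]] is a retract of [S[X]] through [x_i |-> X_i + theta x_i] and
   [X_i |-> x_i - psi (theta x_i)], compatibly with [I] and [(J, X)]. *)
Lemma rees_kernel_generated_mpoly_congr (k S : comNzRingType) n s t
    (theta : {rmorphism {mpoly k[n]} -> S}) (psi : {rmorphism S -> {mpoly k[n]}})
    (f : 'I_s -> {mpoly k[n]}) (g : 'I_t -> S) N :
  (forall c, psi (theta c%:MP) = c%:MP) ->
  (forall i, ideal_span (range g) (theta (f i))) ->
  (forall j, ideal_span (range f) (psi (g j))) ->
  (forall i, ideal_span (range f) (psi (theta 'X_i) - 'X_i)) -> (0 < N)%N ->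
  rees_kernel_generated_upto g N -> rees_kernel_generated_upto f N.
Proof.
move=> psiC fg gf psiX N0 Gg.
have [T [iota [X [r [G [GN Gi GX Gl univ]]]]]] :=
  rees_kernel_generated_adjoin_vars n N0 Gg.
have [tau [tauE tauX]] := univ _ psi (fun i => 'X_i - psi (theta 'X_i)).
pose sigma : {rmorphism {mpoly k[n]} -> T} :=
  mmap (iota \o theta \o @mpolyC n k) (fun i => X i + iota (theta 'X_i)).
have sigmaC c : sigma c%:MP = iota (theta c%:MP) by apply: mmapC.
have sigmaX i : sigma 'X_i = X i + iota (theta 'X_i).
  by rewrite /sigma /= mmapX mmap1U.
have idG := is_ideal_span (range G).
apply: (rees_kernel_generated_retract (sigma := sigma) (tau := tau)) GN => //.
- apply: (mpoly_morph_ext (g := tau \o sigma) (h := idfun)) => [c|i].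
    by rewrite [LHS]/= sigmaC tauE psiC.
  by rewrite [LHS]/= sigmaX rmorphD tauE tauX subrK.
(* [sigma] and [iota \o theta] agree modulo the [X i], which lie in the span of [G], so only
   [iota (theta (f i))] is left. *)
- move=> i; rewrite -(subrK (iota (theta (f i))) (sigma _)).
  have [G0 GD _] := idG; apply: GD; last first.
    by apply: ideal_span_morph (fg i) => // _ [j _ <-].
  apply: (mpoly_morph_congr (g := sigma) (h := iota \o theta)) => // [c|j].
    by rewrite sigmaC subrr.
  by rewrite sigmaX addrK.
- move=> l; case: (Gl l) => [[j ->]|[i ->]]; first by rewrite tauE.
  by rewrite tauX -opprB; apply: is_idealN => //; apply: is_ideal_span.
Qed.

(** * Lifting the isomorphism and transferring the relation type *)

(** Polynomial rings are free, so [F] and its inverse lift by choosing representatives for the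
    images of the variables; the lifts are inverse modulo the ideals. *)
Lemma quot_algebra_isomorphic_lift (k : comNzRingType) n m
    (I : ideal {mpoly k[n]}) (J : ideal {mpoly k[m]}) :
  quot_algebra_isomorphic I J ->
  exists (theta : {rmorphism {mpoly k[n]} -> {mpoly k[m]}})
    (psi : {rmorphism {mpoly k[m]} -> {mpoly k[n]}}),
    [/\ (forall c, theta c%:MP = c%:MP) /\ (forall c, psi c%:MP = c%:MP),
        forall p, I p -> J (theta p), forall q, J q -> I (psi q),
        forall p, I (psi (theta p) - p) & forall q, J (theta (psi q) - q)].
Proof.
case=> F [Fscal [F' FK F'K]].
pose piI := \pi_(ideal_quot I)%qT; pose piJ := \pi_(ideal_quot J)%qT.
have piIE p q : piI p = piI q <-> I (p - q) by apply: ideal_quot_eqP.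
have piJE p q : piJ p = piJ q <-> J (p - q) by apply: ideal_quot_eqP.
pose theta : {rmorphism _ -> _} := mmap (@mpolyC m k) (fun i => repr (F (piI 'X_i))).
pose psi : {rmorphism _ -> _} := mmap (@mpolyC n k) (fun j => repr (F' (piJ 'X_j))).
have thetaC c : theta c%:MP = c%:MP by apply: mmapC.
have psiC c : psi c%:MP = c%:MP by apply: mmapC.
have thetaX i : piJ (theta 'X_i) = F (piI 'X_i).
  by rewrite /theta /= mmapX mmap1U /piJ reprK.
have psiX j : piI (psi 'X_j) = F' (piJ 'X_j).
  by rewrite /psi /= mmapX mmap1U /piI reprK.
have piIM p q : piI (p * q) = piI p * piI q by apply: pi_ideal_quot_mul.
have piJM p q : piJ (p * q) = piJ p * piJ q by apply: pi_ideal_quot_mul.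
have piIZ c p : piI (c *: p) = c *: piI p by apply: pi_ideal_quot_scale.
have piJZ c p : piJ (c *: p) = c *: piJ p by apply: pi_ideal_quot_scale.
(* [theta] lifts [F]; the [k]-linearity of [F] enters for constants. *)
have thetaE p : piJ (theta p) = F (piI p).
  elim/mpoly_generated_ind: p => [|p q IHp IHq|c p IHp|i p IHp].
  - by rewrite rmorph1 [RHS](rmorph1 F).
  - by rewrite rmorphD /piJ /piI !raddfD /= -/piJ IHp IHq.
  - by rewrite rmorphM thetaC !mul_mpolyC piJZ piIZ IHp Fscal.
  - by rewrite rmorphM piJM piIM rmorphM IHp thetaX.
have idJ := idealP J.
have thetapsi q : J (theta (psi q) - q).
  apply: (mpoly_morph_congr (g := theta \o psi) (h := idfun)) => // [c|j] /=.
    by rewrite psiC thetaC subrr; case: idJ.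
  by apply/piJE; rewrite thetaE psiX F'K.
(* Memberships in [I] are tested after applying [F], where [thetaE] and [thetapsi] settle them. *)
have Finj : injective F := can_inj FK.
exists theta, psi; split=> // [p Ip|q Jq|p].
- rewrite -[theta p]subr0; apply/piJE; rewrite thetaE.
  have -> : piI p = piI 0 by apply/piIE; rewrite subr0.
  by rewrite -thetaE rmorph0.
- rewrite -[psi q]subr0; apply/piIE; apply: Finj; rewrite -!thetaE rmorph0.
  apply/piJE; rewrite subr0 -(subrK q (theta _)).
  by case: idJ => _ JD _; apply: JD.
- by apply/piIE; apply: Finj; rewrite -!thetaE; apply/piJE.
Qed.

(** Generation is compared in both directions: from [f] to [g] so that [N] works for [g], and from
    [g] to [f] so that it stays minimal. *)
Lemma relation_type_transfer (k : comNzRingType) n m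
    (I : ideal {mpoly k[n]}) (J : ideal {mpoly k[m]})
    (theta : {rmorphism {mpoly k[n]} -> {mpoly k[m]}})
    (psi : {rmorphism {mpoly k[m]} -> {mpoly k[n]}}) N :
  (forall c, theta c%:MP = c%:MP) -> (forall c, psi c%:MP = c%:MP) ->
  (forall p, I p -> J (theta p)) -> (forall q, J q -> I (psi q)) ->
  (forall p, I (psi (theta p) - p)) -> (forall q, J (theta (psi q) - q)) ->
  (exists s (f : 'I_s -> _), ideal_set I = ideal_span (range f) /\
     relation_type_wrt f N) ->
  exists t (g : 'I_t -> _), ideal_set J = ideal_span (range g) /\
    relation_type_wrt g N.
Proof.
move=> thetaC psiC IJ JI psitheta thetapsi [s [f [If [N1 fN fmin]]]].
have [idI idJ] := (idealP I, idealP J).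
(* The [theta (f j)] generate [J] only up to the defect of [theta \o psi] from the identity, so the
   defects at the variables are added. *)
pose g i := match split i with
  | inl j => theta (f j) | inr j => theta (psi 'X_j) - 'X_j end : {mpoly k[m]}.
have If_ i : I (f i) by rewrite If; apply: ideal_span_incl; exists i.
have gl j : range g (theta (f j)).
  by exists (lshift _ j) => //; rewrite /g -[lshift _ j]/(unsplit (inl j)) unsplitK.
have gr j : range g (theta (psi 'X_j) - 'X_j).
  by exists (rshift _ j) => //; rewrite /g -[rshift _ j]/(unsplit (inr j)) unsplitK.
have Jg : ideal_set J = ideal_span (range g).
  apply/seteqP; split=> [q Jq|]; last first.
    apply: ideal_span_sub => // _ [i _ <-]; rewrite /g.
    by case: split => j; [apply: IJ | apply: thetapsi].
  have idg := is_ideal_span (range g).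
  have gtheta : ideal_span (range g) (theta (psi q)).
    have := JI _ Jq; rewrite If; apply: ideal_span_morph => // _ [i _ <-].
    exact: ideal_span_incl.
  (* The defect at [q] lies in the span because the defects at the variables do. *)
  rewrite -[q](subKr (theta (psi q))); apply: is_idealB => //.
  apply: (mpoly_morph_congr (g := theta \o psi) (h := idfun)) => // [c|j] /=.
    by rewrite psiC thetaC subrr; case: idg.
  exact: ideal_span_incl.
have Jg_ i : J (g i) by rewrite Jg; apply: ideal_span_incl; exists i.
exists (s + m)%N, g; split=> //; split=> // [|M M1 gM].
  apply: (rees_kernel_generated_mpoly_congr (theta := psi) (psi := theta)) fN => //.
  - by move=> c; rewrite psiC.
  - by move=> i; rewrite -If; apply: JI.
  - by move=> j; rewrite -Jg; apply: IJ.
  - by move=> i; rewrite -Jg; apply: thetapsi.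
apply: fmin => //.
apply: (rees_kernel_generated_mpoly_congr (theta := theta) (psi := psi)) gM => //.
- by move=> c; rewrite thetaC.
- by move=> i; rewrite -Jg; apply: IJ.
- by move=> j; rewrite -If; apply: JI.
- by move=> i; rewrite -If; apply: psitheta.
Qed.

Theorem theorem3p1 (k : fieldType) (n m : nat)
    (I : ideal {mpoly k[n]}) (J : ideal {mpoly k[m]}) :
  quot_algebra_isomorphic I J -> relation_type I = relation_type J.
Proof.
move=> /quot_algebra_isomorphic_lift[theta [psi [[thetaC psiC] IJ JI pt tp]]].
(* Both sides are [xget] of a set of integers, so it is enough that the two sets coincide. *)
rewrite /relation_type; congr xget; apply/seteqP; split=> N.
  exact: relation_type_transfer pt tp.
exact: relation_type_transfer tp pt.
Qed.
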